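(* Let $D=(V(D),E(D),w)$ be a weighted oriented graph in which every source and every sink has weight $1$, and suppose that its underlying graph $G$ is very well-covered. Then $G$ has a perfect matching $P$ and the following conditions are equivalent: (a) $I(D)$ is unmixed; (b) if $a\in V(D)$, $w(a)>1$, $b'\in N_D^+(a)$ and $\{b,b'\}\in P$, then $N_D(b)\subset N_D^+(a)$.
   Context: All graphs are finite and simple. A weighted oriented graph $D=(V(D),E(D),w)$ with underlying simple graph $G$ consists of $V(D)=V(G)$, a set $E(D)\subset V(D)\times V(D)$ with $E(G)=\{\{x,y\}: (x,y)\in E(D)\}$ and $|E(D)|=|E(G)|$ (each edge of $G$ gets exactly one direction), and a weight function $w:V(D)\to\mathbb{N}_+=\{1,2,\dots\}$. A source is a vertex with only outgoing edges; a sink is a vertex with only incoming edges. Standing convention: sources and sinks have weight $1$. For a vertex $x$: $N_D^+(x)=\{y:(x,y)\in E(D)\}$, $N_D^-(x)=\{y:(y,x)\in E(D)\}$, $N_D(x)=N_D^+(x)\cup N_D^-(x)$. If $V(D)=\{x_1,\dots,x_n\}$, view the vertices as variables of $R=K[x_1,\dots,x_n]$, $K$ a field. The edge ideal of $D$ is $I(D)=(x_ix_j^{w(x_j)} : (x_i,x_j)\in E(D))\subset R$. An ideal is unmixed if all its associated primes have the same height. A matching is a set of pairwise disjoint edges; it is perfect if it covers all vertices. $\tau(G)$ is the minimum cardinality of a vertex cover of $G$. A stable set is a set of vertices containing no edge; $G$ is well-covered if all its maximal (under inclusion) stable sets have the same cardinality, and very well-covered if it is well-covered, has no isolated vertices and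 $|V(G)|=2\tau(G)$. *)

(* Defs.v *)
From mathcomp Require Import all_boot all_order all_algebra.
From mathcomp Require Import mpoly.

Set Implicit Arguments.
Unset Strict Implicit.
Unset Printing Implicit Defensive.

Import GRing.Theory.

(** * Simple graphs, given by a symmetric irreflexive relation *)

Section Graphs.

Variables (T : finType) (e : rel T).

Definition edge_set : {set {set T}} := [set [set x; y] | x in T, y in e x].

Definition perfect_matching (P : {set {set T}}) : bool :=
  [&& P \subset edge_set, trivIset P & cover P == [set: T]].

Definition vertex_cover (C : {set T}) : bool :=
  [forall x, forall y, e x y ==> ((x \in C) || (y \in C))].

Definition tau : nat := #|[arg min_(C < [set: T] | vertex_cover C) #|C|]|.

Definition stable (S : {set T}) : bool :=
  [forall x in S, forall y in S, ~~ e x y].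

Definition well_covered : Prop :=
  forall A B : {set T}, maxset stable A -> maxset stable B -> #|A| = #|B|.

Definition isolated (x : T) : bool := [forall y, ~~ e x y].

Definition very_well_covered : Prop :=
  [/\ well_covered, forall x, ~~ isolated x & #|T| = (2 * tau)%N].

End Graphs.

(** * Weighted oriented graphs on the vertex set x_0, ..., x_(n-1) *)

(* [dedge_asym] says that each edge gets exactly one direction; with i = j it
   also excludes loops. *)
Record wograph (n : nat) := WOGraph {
  dedge : rel 'I_n;
  weight : 'I_n -> nat;
  dedge_asym : forall i j, dedge i j -> ~~ dedge j i;
  weight_gt0 : forall i, (0 < weight i)%N
}.

Section WOGraphs.

Variables (n : nat) (D : wograph n).

Definition underlying : rel 'I_n := fun i j => dedge D i j || dedge D j i.

Definition out_nbh (x : 'I_n) : {set 'I_n} := [set y | dedge D x y].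
Definition in_nbh (x : 'I_n) : {set 'I_n} := [set y | dedge D y x].
Definition nbh (x : 'I_n) : {set 'I_n} := out_nbh x :|: in_nbh x.

Definition source (x : 'I_n) : bool := in_nbh x == set0.
Definition sink (x : 'I_n) : bool := out_nbh x == set0.

End WOGraphs.

(** * Ideals *)

(* The ideals of MathComp's ring_quotient are boolean, hence decidable,
   predicates; associated primes and heights quantify over all ideals, so
   ideals are [Prop]-valued predicates here. *)

Local Open Scope ring_scope.

Section Ideals.

Variable R : comNzRingType.

Implicit Types I P Q : R -> Prop.

Definition is_ideal I : Prop :=
  [/\ I 0, forall f g, I f -> I g -> I (f + g) & forall f g, I g -> I (f * g)].

Definition prime_ideal P : Prop :=
  [/\ is_ideal P, ~ P 1 & forall f g, P (f * g) -> P f \/ P g].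

Definition ideal_gen (J : finType) (p : pred J) (g : J -> R) : R -> Prop :=
  fun f => exists c : J -> R, f = \sum_(j | p j) c j * g j.

(* P is a prime of the form (I : f). *)
Definition associated_prime I P : Prop :=
  prime_ideal P /\ exists f : R, forall g : R, P g <-> I (g * f).

Definition proper_subideal P Q : Prop :=
  (forall f, P f -> Q f) /\ (exists f, Q f /\ ~ P f).

(* C 0, ..., C k is a chain of k strict inclusions of primes ending at P. *)
Definition prime_chain P (k : nat) (C : nat -> R -> Prop) : Prop :=
  [/\ forall i, (i <= k)%N -> prime_ideal (C i),
      forall i, (i < k)%N -> proper_subideal (C i) (C i.+1)
    & forall f, C k f <-> P f].

Definition has_height P (h : nat) : Prop :=
  (exists C, prime_chain P h C) /\
  (forall k C, prime_chain P k C -> (k <= h)%N).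

Definition unmixed I : Prop :=
  exists h : nat, forall P, associated_prime I P -> has_height P h.

End Ideals.

Definition edge_ideal (K : fieldType) (n : nat) (D : wograph n) :
    {mpoly K[n]} -> Prop :=
  ideal_gen (fun a : 'I_n * 'I_n => dedge D a.1 a.2)
            (fun a => 'X_(a.1) * 'X_(a.2) ^+ weight D a.2 : {mpoly K[n]}).

Arguments edge_ideal K {n} D.

(* Main.v *)
(** The associated primes of I(D) are the ideals (x : x in C) for the strong
    vertex covers C, and such a prime has height #|C|; so I(D) is unmixed iff all
    strong covers have the same size.  Complements of maximal stable sets are
    strong covers, of size n/2, and P has n/2 edges.  If {b, b'} is in P, every
    neighbour of b is adjacent to every neighbour of b', since otherwise some
    maximal stable set would miss {b, b'}.

    Under (b) a strong cover C cannot contain both b and b'.  If both have a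
    neighbour outside C, these two are adjacent, but C covers that edge.  If b'
    is strong through some a -> b', then N(b) \subset N+(a) \subset C, so b is
    strong through some a' -> b, and symmetrically N(b') \subset N+(a'), whence
    a -> a' -> a.  Conversely, if (b) fails at a, b, b' and c \in N(b), then
    c -> a, and the complement of a stable set through c, maximal among those
    avoiding a and N+(a), is a strong cover containing b and b'.

    The bound ht (x : x in C) <= #|C| reduces to dim K[x_1, ..., x_n] <= n: along
    a chain of primes P_0 < ... < P_k, elements of P_(i+1) \ P_i are algebraically
    independent, while n + 1 polynomials never are. *)

Require Import Defs.
From mathcomp Require Import all_boot all_order all_algebra.
From mathcomp Require Import mpoly.
From mathcomp Require Import zify.

Set Implicit Arguments.
Unset Strict Implicit.
Unset Printing Implicit Defensive.

Import GRing.Theory.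
Local Open Scope ring_scope.

(** * Chains of primes in polynomial rings *)

Lemma idealB (R : comNzRingType) (I : R -> Prop) (f g : R) :
  is_ideal I -> I f -> I g -> I (f - g).
Proof. by case=> _ ID IM If Ig; rewrite -mulN1r; apply/ID/IM. Qed.

Lemma idealMr (R : comNzRingType) (I : R -> Prop) (f g : R) :
  is_ideal I -> I f -> I (f * g).
Proof. by case=> _ _ IM If; rewrite mulrC; apply: IM. Qed.

Lemma ideal_sum (R : comNzRingType) (I : R -> Prop) (J : Type) (r : seq J)
    (p : pred J) (F : J -> R) :
  is_ideal I -> (forall j, p j -> I (F j)) -> I (\sum_(j <- r | p j) F j).
Proof. by case=> I0 ID _ IF; elim/big_ind: _. Qed.

(** * Monomial ideals and the primes generated by variables *)

Section MonomialIdeals.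

Variables (K : fieldType) (n : nat).

Implicit Types (U V W : pred 'X_{1..n}) (f g : {mpoly K[n]}) (C : {set 'I_n}).

Definition monomial_ideal U : {mpoly K[n]} -> Prop :=
  fun f => {in msupp f, forall m, U m}.

Definition upward_closed U := forall m k : 'X_{1..n}, U m -> U (m + k)%MM.

Lemma monomial_idealX U m : monomial_ideal U 'X_[m] <-> U m.
Proof.
split=> [H|Um k]; first by apply: H; rewrite msuppX inE.
by rewrite msuppX inE => /eqP->.
Qed.

Lemma monomial_ideal_ideal U : upward_closed U -> is_ideal (monomial_ideal U).
Proof.
move=> up; split=> [m|f g If Ig m|f g Ig m]; first by rewrite msupp0.
  by move/msuppD_le; rewrite mem_cat => /orP[/If|/Ig].
move/msuppM_le/allpairsP => [[m1 m2] /= [_ m2g ->]].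
by rewrite addmC; apply: up; apply: Ig.
Qed.

Definition mrestr U f : {mpoly K[n]} :=
  \sum_(m <- msupp f | U m) f@_m *: 'X_[m].

Lemma mrestrD U f : f = mrestr U f + mrestr (predC U) f.
Proof. by rewrite {1}[f]mpolyE (bigID U). Qed.

Lemma msupp_mrestr U f m : m \in msupp (mrestr U f) -> (m \in msupp f) /\ U m.
Proof.
move/msupp_sum_le/flatten_mapP => [k]; rewrite mem_filter => /andP[Uk kf].
by move/msuppZ_le; rewrite msuppX inE => /eqP->.
Qed.

Lemma mrestr_ideal U f : monomial_ideal U (mrestr U f).
Proof. by move=> m /msupp_mrestr[]. Qed.

Lemma mrestrN_ideal U f :
  mrestr (predC U) f = 0 -> monomial_ideal U f.
Proof. by move=> f0; rewrite [f](mrestrD U) f0 addr0; apply: mrestr_ideal. Qed.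

(* The leading monomial of a product is the product of the leading monomials,
   so no cancellation can hide it. *)
Lemma monomial_idealM_neq U V W f g :
    (forall k m, W k -> V m -> ~~ U (k + m)%MM) ->
    monomial_ideal W f -> monomial_ideal V g -> f != 0 -> g != 0 ->
  ~ monomial_ideal U (f * g).
Proof.
move=> UWV Wf Vg f0 g0 /(_ (mlead (f * g))).
rewrite mlead_supp ?mulf_neq0 // mleadM // => /(_ isT).
by apply/negP/UWV; [apply: Wf | apply: Vg]; apply: mlead_supp.
Qed.

Definition meets C : pred 'X_{1..n} := fun m => [exists i in C, 0 < m i]%N.

Definition var_ideal C : {mpoly K[n]} -> Prop := monomial_ideal (meets C).

Lemma meetsD C m k : meets C (m + k)%MM = meets C m || meets C k.
Proof.
apply/existsP/orP => [[i]|[]/existsP[i /andP[iC mi]]].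
- rewrite mnmDE addn_gt0 => /andP[iC /orP[] mi]; [left|right];
  by apply/existsP; exists i; rewrite iC.
- by exists i; rewrite iC mnmDE addn_gt0 mi.
- by exists i; rewrite iC mnmDE addn_gt0 mi orbT.
Qed.

Lemma meetsU C i : meets C U_(i)%MM = (i \in C).
Proof.
apply/existsP/idP => [[j]|iC]; last by exists i; rewrite iC mnm1E eqxx.
by rewrite mnm1E; case: eqP => [->/andP[]|_]; rewrite ?andbF.
Qed.

Lemma var_idealX C i : var_ideal C 'X_i <-> i \in C.
Proof. by rewrite /var_ideal monomial_idealX meetsU. Qed.

Lemma var_ideal_ideal C : is_ideal (var_ideal C).
Proof. by apply: monomial_ideal_ideal => m k mC; rewrite meetsD mC. Qed.

(** Modulo this ideal each factor may be replaced by its part free of [C]; if both parts are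
    nonzero, the leading monomial of their product is free of [C] too. *)
Lemma var_ideal_prime C : prime_ideal (var_ideal C).
Proof.
split; first exact: var_ideal_ideal.
  move=> /(_ 0%MM); rewrite msupp1 inE eqxx => /(_ isT).
  by case/existsP => i; rewrite mnm0E andbF.
have idC := var_ideal_ideal C.
move=> f g fgC; set f0 := mrestr (predC (meets C)) f.
set g0 := mrestr (predC (meets C)) g.
have [f00|f0_neq0] := eqVneq f0 0; first by left; apply: mrestrN_ideal.
have [g00|g0_neq0] := eqVneq g0 0; first by right; apply: mrestrN_ideal.
exfalso; apply: (@monomial_idealM_neq (meets C) (predC (meets C))
    (predC (meets C)) f0 g0) => //.
- by move=> k m /= kC mC; rewrite meetsD (negPf kC).
- exact: mrestr_ideal.
- exact: mrestr_ideal.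
have -> : f0 * g0 = f * g - (mrestr (meets C) f * g + f0 * mrestr (meets C) g).
  have f0E : f0 = f - mrestr (meets C) f.
    by apply/eqP; rewrite eq_sym subr_eq addrC -mrestrD.
  have g0E : g0 = g - mrestr (meets C) g.
    by apply/eqP; rewrite eq_sym subr_eq addrC -mrestrD.
  by rewrite {1}g0E mulrBr {1}f0E mulrBl opprD addrA.
apply: (idealB idC) => //; case: (idC) => _ ID IM; apply: ID.
  by apply: idealMr idC _; apply: mrestr_ideal.
by apply: IM; apply: mrestr_ideal.
Qed.

Lemma var_idealS C C' f : C \subset C' -> var_ideal C f -> var_ideal C' f.
Proof.
move=> /subsetP sCC' Cf m /Cf /existsP[i /andP[iC mi]].
by apply/existsP; exists i; rewrite mi sCC'.
Qed.

Lemma var_ideal_proper C i :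
  i \notin C -> proper_subideal (var_ideal C) (var_ideal (i |: C)).
Proof.
move=> iC; split=> [f|]; first exact/var_idealS/subsetUr.
by exists 'X_i; rewrite !var_idealX setU11 (negPf iC).
Qed.

Lemma prime_idealX (P : {mpoly K[n]} -> Prop) m :
  prime_ideal P -> P 'X_[m] -> exists2 i, (0 < m i)%N & P 'X_i.
Proof.
case=> _ P1 PM; rewrite mpolyXE_id => Pm.
suff [i _ Pi] : exists2 i : 'I_n, i \in index_enum 'I_n & P ('X_i ^+ m i).
  exists i.
    by rewrite lt0n; apply/negP => /eqP mi; apply: P1; rewrite mi in Pi.
  by elim: (m i) Pi => [/P1//|k IHk]; rewrite exprS => /PM[].
elim: (index_enum _) Pm => [|i r IHr]; first by rewrite big_nil => /P1.
rewrite big_cons => /PM[Pi|/IHr[j jr Pj]]; first by exists i; rewrite ?mem_head.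
by exists j; rewrite // inE jr orbT.
Qed.

End MonomialIdeals.

(** * Lengths of chains of primes and heights *)

Section Dimension.

Variables (K : fieldType) (n : nat).
Local Notation R := {mpoly K[n]}.

(* Exponent vectors of length k with entries less than N; the recursion follows
   the elimination of the first variable in [chain_alg_indep]. *)
Fixpoint exponents (N k : nat) : finType :=
  if k is k'.+1 then ('I_N * exponents N k')%type else unit.

Fixpoint monomial_at N k (a : nat -> R) : exponents N k -> R :=
  match k with
  | 0 => fun _ => 1
  | k'.+1 => fun e => a 0%N ^+ e.1 * monomial_at (fun i => a i.+1) e.2
  end.

Lemma card_exponents N k : #|exponents N k| = (N ^ k)%N.
Proof. by elim: k => [|k IHk]; rewrite ?card_unit //= card_prod card_ord IHk expnS. Qed.

(** Avoiding [P 0], and not just 0, is what the induction needs. Factor out the least occurring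
    power [i0] of [a 0]: primality of [P 0] and [a 0] in [P 1] put the coefficient [S i0] in [P 1],
    against the shifted chain. *)
Lemma chain_alg_indep N k (a : nat -> R) (P : nat -> R -> Prop)
    (c : exponents N k -> K) :
    (forall i, (i <= k)%N -> prime_ideal (P i)) ->
    (forall i f, (i < k)%N -> P i f -> P i.+1 f) ->
    (forall i, (i < k)%N -> P i.+1 (a i) /\ ~ P i (a i)) ->
    (exists e, c e != 0) ->
  ~ P 0%N (\sum_e c e *: monomial_at a e).
Proof.
elim: k a P c => [|k IHk] a P c Pprime Psub Pa [e ce].
  have [[_ _ PM] P1 _] := Pprime 0%N isT.
  rewrite (big_pred1 tt) /= => [/(PM (c tt)^-1%:MP)|[]//].
  by case: e ce => ce; rewrite mul_mpolyC scalerA mulVf // scale1r.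
have [i0 c_i0 min_i0] : exists2 i : 'I_N, [exists e, c (i, e) != 0]
    & forall j : 'I_N, [exists e, c (j, e) != 0] -> (i <= j)%N.
  have ex : [exists e', c (e.1, e') != 0] by apply/existsP; exists e.2; case: e ce.
  by case: (@arg_minnP _ e.1 (fun i => [exists e', c (i, e') != 0]) val ex) => i ci min_i;
    exists i.
pose S i := \sum_e c (i, e) *: monomial_at (fun i => a i.+1) e.
have S0 (i : 'I_N) : (i < i0)%N -> S i = 0.
  move=> lt_i_i0; apply: big1 => e' _; have [->|ce'] := eqVneq (c (i, e')) 0.
    by rewrite scale0r.
  have : (i0 <= i)%N by apply: min_i0; apply/existsP; exists e'.
  by rewrite leqNgt lt_i_i0.
pose T := \sum_(i < N | (i0 < i)%N) a 0%N ^+ (i - i0.+1) * S i.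
have -> : \sum_e c e *: monomial_at a e = a 0%N ^+ i0 * (S i0 + a 0%N * T).
  transitivity (\sum_(i < N) a 0%N ^+ i * S i).
    rewrite /S; under [RHS]eq_bigr do rewrite mulr_sumr.
    by rewrite pair_big /=; apply: eq_bigr => -[i e'] _ /=; rewrite scalerAr.
  rewrite (bigD1 i0) //= mulrDr; congr (_ + _).
  rewrite (bigID (fun i : 'I_N => (i0 < i)%N)) /= [X in _ + X]big1 ?addr0.
    rewrite mulrA -exprSr mulr_sumr; apply: eq_big => [i|i /andP[_ lt_i0_i]].
      by rewrite andb_idl // => /gtn_eqF; rewrite -val_eqE /= => ->.
    by rewrite mulrA -exprD subnKC.
  move=> i /andP[ne_i]; rewrite -leqNgt leq_eqVlt (inj_eq val_inj) (negPf ne_i) /=.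
  by move/S0->; rewrite mulr0.
have [[_ _ PM] P1 Pprime0] := Pprime 0%N isT.
have [Pa1 Pa0] := Pa 0%N isT.
case/Pprime0 => [|/Psub -/(_ isT) P1S].
  by elim: (val i0) => [/P1//|m IHm]; rewrite exprS => /Pprime0[].
case: (IHk (fun i => a i.+1) (fun i => P i.+1) (fun e => c (i0, e))).
- by move=> i ik; apply: (Pprime i.+1).
- by move=> i f ik; apply: (Psub i.+1).
- by move=> i ik; apply: (Pa i.+1).
- exact/existsP.
have id1 : is_ideal (P 1%N) by case: (Pprime 1%N isT).
rewrite -[X in P _ X](addrK (a 0%N * T)); apply: (idealB id1) => //.
exact: (idealMr _ id1).
Qed.

Definition deg_le d (f : R) := monomial_ideal (fun m => mdeg m <= d)%N f.

Lemma deg_le1 : deg_le 0 1.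
Proof. by move=> m; rewrite msupp1 inE => /eqP->; rewrite mdeg0. Qed.

Lemma deg_leW d e f : (d <= e)%N -> deg_le d f -> deg_le e f.
Proof. by move=> le_de df m /df /leq_trans; apply. Qed.

Lemma deg_leM d e f g : deg_le d f -> deg_le e g -> deg_le (d + e) (f * g).
Proof.
move=> df eg m /msuppM_le/allpairsP => -[[m1 m2] /= [/df m1d /eg m2e ->]].
by rewrite mdegD leq_add.
Qed.

Lemma deg_le_exp d f i : deg_le d f -> deg_le (i * d) (f ^+ i).
Proof.
move=> df; elim: i => [|i IHi]; first exact: deg_le1.
by rewrite exprS mulSn; apply: deg_leM.
Qed.

Lemma deg_le_monomial_at N k (a : nat -> R) d (e : exponents N k) :
  (forall i, (i < k)%N -> deg_le d (a i)) ->
  deg_le (k * (N * d)) (monomial_at a e).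
Proof.
elim: k a e => [|k IHk] a e ad /=; first exact: deg_le1.
rewrite mulSn; apply: deg_leM; last by apply: IHk => i; apply: (ad i.+1).
apply: (deg_leW _ (deg_le_exp (i := e.1) (ad 0%N isT))).
by rewrite leq_mul2r ltnW ?orbT.
Qed.

(** The matrix of the coefficients of the [v e] at the monomials [g x] has more rows than columns,
    hence a nonzero left kernel. *)
Lemma linear_dependence (E F : finType) (v : E -> R) (g : F -> 'X_{1..n}) :
    (forall e, {in msupp (v e), forall m, exists x, m = g x}) ->
    (#|F| < #|E|)%N ->
  exists2 c : E -> K, (exists e, c e != 0) & \sum_e c e *: v e = 0.
Proof.
move=> vg ltFE; pose M := \matrix_(i < #|E|, j < #|F|) (v (enum_val i))@_(g (enum_val j)).
have /rowV0Pn[u /sub_kermxP uM u0] : kermx M != 0.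
  by rewrite kermx_eq0 /row_free neq_ltn (leq_ltn_trans (rank_leq_col M)).
exists (fun e => u 0 (enum_rank e)).
  have /rV0Pn[i ui] := u0; exists (enum_val i); by rewrite enum_valK.
apply/mpolyP => m; rewrite mcoeff0 raddf_sum /=.
have [[x ->]|mg] : (exists x, m = g x) \/ (forall x, m != g x).
- have [/existsP[x /eqP->]|/existsPn mg] := boolP [exists x, m == g x];
  by [left; exists x | right].
- move/matrixP/(_ 0 (enum_rank x)): uM; rewrite !mxE => {2}<-.
  rewrite [RHS](reindex enum_rank) /=; last exact/onW_bij/enum_rank_bij.
  by apply: eq_bigr => e _; rewrite mcoeffZ !mxE !enum_rankK.
apply: big1 => e _; rewrite mcoeffZ memN_msupp_eq0 ?mulr0 //.
by apply/negP => /vg[x /eqP]; rewrite (negPf (mg x)).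
Qed.

(* There are N ^ n.+1 monomials in the a i with exponents less than N, and
   they lie in a space of dimension at most (N * D) ^ n with D independent
   of N. *)
Lemma alg_dependence (a : nat -> R) : exists N (c : exponents N n.+1 -> K),
  (exists e, c e != 0) /\ \sum_e c e *: monomial_at a e = 0.
Proof.
have [d ad] : exists d, forall i, (i < n.+1)%N -> deg_le d (a i).
  exists (\max_(i < n.+1) msize (a i)) => i lt_in m mi.
  apply: leq_trans (leq_bigmax (Ordinal lt_in)).
  exact/ltnW/mmeasure_mnm_lt.
(* [D] keeps all exponents below [N * D], and [N] exceeds [D ^ n], so that
   [(N * D) ^ n < N ^ n.+1]. *)
pose D := (n.+1 * d).+1; pose N := (D ^ n).+1.
have [||c c0 cv] := @linear_dependence (exponents N n.+1)
    {ffun 'I_n -> 'I_(N * D)} (monomial_at a)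
    (fun h => [multinom h i : nat | i < n]); last by exists N, c.
- move=> e m /(deg_le_monomial_at ad) mdeg_m.
  have m_lt i : (m i < N * D)%N.
    rewrite /D mulnS mulnCA; apply: (@leq_ltn_trans (n.+1 * (N * d))); last by lia.
    by apply: leq_trans mdeg_m; rewrite mdegE (bigD1 i) //= leq_addr.
  exists [ffun i => Ordinal (m_lt i)].
  by apply/mnmP => i; rewrite mnmE ffunE.
by rewrite card_exponents card_ffun !card_ord expnMn expnSr ltn_pmul2l ?expn_gt0.
Qed.

Lemma prime_chain_length (P : R -> Prop) k C : prime_chain P k C -> (k <= n)%N.
Proof.
move=> [Cprime Cprop _]; rewrite leqNgt; apply/negP => lt_nk.
have /fin_all_exists[h hP] (i : 'I_k) : exists f, C i.+1 f /\ ~ C i f.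
  by case: (Cprop i (ltn_ord i)).
(* The default 0 is never reached: only indices up to [n], which is less than [k], are used. *)
pose a i := oapp h 0 (insub i).
have [N [c [c0 ca]]] := alg_dependence a.
apply: (@chain_alg_indep N n.+1 a C c) => //.
- by move=> i /leq_trans le_i; apply: Cprime; apply: le_i.
- by move=> i f /leq_trans/(_ lt_nk)/Cprop[+ _]; apply.
- move=> i /leq_trans/(_ lt_nk) lt_ik; rewrite /a insubT /=.
  exact: (hP (Ordinal lt_ik)).
by rewrite ca; case: (Cprime 0%N isT) => -[].
Qed.

Lemma prime_chain_rcons (P Q : R -> Prop) k C :
    prime_chain P k C -> prime_ideal Q -> proper_subideal P Q ->
  prime_chain Q k.+1 (fun i => if (i <= k)%N then C i else Q).
Proof.
move=> [Cprime Cprop CP] Qprime [PQ [f [Qf Pf]]]; split=> [i|i|f'].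
- by case: (leqP i k) => [le_ik _|//]; apply: Cprime.
- rewrite ltnS => le_ik; rewrite le_ik; case: (ltnP i k) => [/Cprop//|le_ki].
  have -> : i = k by apply/eqP; rewrite eqn_leq le_ik.
  by split=> [f' /CP/PQ//|]; exists f; split=> // /CP.
by rewrite ltnn.
Qed.

(** The variables of [C] are added one at a time, starting from the zero ideal. *)
Lemma var_ideal_chain C :
  exists Ch, prime_chain (var_ideal C : R -> Prop) #|C| Ch.
Proof.
move: {-2}#|C| (erefl #|C|) => k; elim: k C => [|k IHk] C Ck.
  exists (fun=> var_ideal C); split=> //; first by move=> *; apply: var_ideal_prime.
have /card_gt0P[i iC] : (0 < #|C|)%N by rewrite -Ck.
have [Ch ChP] : exists Ch, prime_chain (var_ideal (C :\ i) : R -> Prop) k Ch.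
  by apply: IHk; move: Ck; rewrite (cardsD1 i) iC => -[].
exists (fun j => if (j <= k)%N then Ch j else var_ideal C).
apply: prime_chain_rcons ChP (var_ideal_prime _ _) _.
by have := @var_ideal_proper K n (C :\ i) i; rewrite setD1K // !inE eqxx; apply.
Qed.

(* A chain ending at [var_ideal C] extends by #|~: C| steps, up to the ideal of
   all variables, and the resulting chain has length at most n. *)
Lemma var_ideal_chain_length C k Ch :
  prime_chain (var_ideal C : R -> Prop) k Ch -> (k <= #|C|)%N.
Proof.
have [r] := ubnP #|~: C|; elim: r C k Ch => // r IHr C k Ch ltCr ChP.
have [C0|[i]] := set_0Vmem (~: C).
  by rewrite -[C]setCK C0 setC0 cardsT card_ord; apply: prime_chain_length ChP.
rewrite inE => iC.
have := prime_chain_rcons ChP (var_ideal_prime K (i |: C)) (var_ideal_proper K iC).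
move/IHr; rewrite cardsU1 iC ltnS; apply.
by move: ltCr; rewrite (cardsD1 i) inE iC setCU setIC -setDE.
Qed.

Lemma var_ideal_height C : has_height (var_ideal C : R -> Prop) #|C|.
Proof.
split; first exact: var_ideal_chain.
by move=> k Ch; apply: var_ideal_chain_length.
Qed.

Lemma has_height_uniq (P : R -> Prop) h h' :
  has_height P h -> has_height P h' -> h = h'.
Proof.
move=> [[C CP] max_h] [[C' CP'] max_h'].
by apply/eqP; rewrite eqn_leq (max_h' _ _ CP) (max_h _ _ CP').
Qed.

Lemma prime_chain_ext (P Q : R -> Prop) k C :
  (forall f, P f <-> Q f) -> prime_chain P k C -> prime_chain Q k C.
Proof. by move=> PQ [? ? CP]; split=> // f; rewrite CP. Qed.

Lemma has_height_ext (P Q : R -> Prop) h :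
  (forall f, P f <-> Q f) -> has_height P h -> has_height Q h.
Proof.
move=> PQ [[C CP] max_h]; split; first by exists C; apply: prime_chain_ext CP.
by move=> k C' C'Q; apply: (max_h k C'); apply: prime_chain_ext C'Q => f; rewrite PQ.
Qed.

End Dimension.

(** * Associated primes of the edge ideal *)

Section EdgeIdeal.

Variables (K : fieldType) (n : nat) (D : wograph n).
Local Notation R := {mpoly K[n]}.
Implicit Types (C : {set 'I_n}) (m k : 'X_{1..n}).

Lemma dedge_irr i : dedge D i i = false.
Proof. by apply/negP => ii; have := dedge_asym ii; rewrite ii. Qed.

(** Exponents of the monomials divisible by a generator of I(D); as [i] and [j] differ, the two
    coordinates can be tested separately. *)
Definition edge_mon : pred 'X_{1..n} := fun m =>
  [exists i, exists j, [&& dedge D i j, 0 < m i & weight D j <= m j]]%N.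

Lemma edge_monP m :
  reflect (exists i j, [/\ dedge D i j, 0 < m i & weight D j <= m j]%N) (edge_mon m).
Proof.
apply: (iffP existsP) => [[i /existsP[j /and3P ij]]|[i [j /and3P ij]]].
  by exists i, j.
by exists i; apply/existsP; exists j.
Qed.

Lemma edge_mon_up : upward_closed edge_mon.
Proof.
move=> m k /edge_monP[i [j [ij mi mj]]]; apply/edge_monP; exists i, j.
by rewrite !mnmDE ltn_addr ?(leq_trans mj) ?leq_addr.
Qed.

Lemma ideal_gen_ideal (S : comNzRingType) (J : finType) (p : pred J) (g : J -> S) :
  is_ideal (ideal_gen p g).
Proof.
split=> [|f f' [c ->] [c' ->]|f f' [c ->]].
- by exists (fun=> 0); rewrite big1 // => j _; rewrite mul0r.
- exists (fun j => c j + c' j); rewrite -big_split; apply: eq_bigr => j _.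
  by rewrite mulrDl.
exists (fun j => f * c j); rewrite mulr_sumr; apply: eq_bigr => j _.
by rewrite mulrA.
Qed.

Lemma ideal_gen_mem (S : comNzRingType) (J : finType) (p : pred J) (g : J -> S) j :
  p j -> ideal_gen p g (g j).
Proof.
move=> pj; exists (fun i => (i == j)%:R); rewrite (bigD1 j) //= eqxx mul1r.
by rewrite big1 ?addr0 // => i /andP[_ /negPf->]; rewrite mul0r.
Qed.

Lemma edge_idealP (f : R) : edge_ideal K D f <-> monomial_ideal edge_mon f.
Proof.
have idI := @ideal_gen_ideal R _ (fun a : 'I_n * 'I_n => dedge D a.1 a.2)
            (fun a => 'X_(a.1) * 'X_(a.2) ^+ weight D a.2).
split=> [[c ->]|If].
  have idM := @monomial_ideal_ideal K n _ edge_mon_up.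
  apply: (ideal_sum _ idM) => -[i j] /= ij; case: (idM) => _ _; apply.
  rewrite mpolyXn -mpolyXD monomial_idealX; apply/edge_monP; exists i, j.
  by rewrite !mnmDE !mulmnE !mnm1E !eqxx mul1n leq_addl.
rewrite [f]mpolyE big_seq; apply: (ideal_sum _ idI) => m /If/edge_monP[i [j [ij mi mj]]].
rewrite -mul_mpolyC; case: (idI) => _ _; apply.
have -> : m = ((m - (U_(i) + U_(j) *+ weight D j)) + (U_(i) + U_(j) *+ weight D j))%MM.
  rewrite submK //; apply/mnm_lepP => x; rewrite mnmDE mulmnE !mnm1E.
  have ne_ij : i != j by apply: contraTneq ij => <-; rewrite dedge_irr.
  case: eqP => [<-|_]; first by rewrite eq_sym (negPf ne_ij).
  by case: eqP => [<-|_]; rewrite ?mul1n.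
rewrite mpolyXD; case: (idI) => _ _; apply.
by rewrite mpolyXD -mpolyXn; apply: (@ideal_gen_mem R _ _ _ (i, j)).
Qed.

(* For x without a neighbour outside C, i.e. x \in L3(C), the literature asks for
   an in-neighbour of weight > 1 in L2(C) or L3(C), i.e. one whose
   out-neighbourhood lies in C. *)
Definition strong_cover C : Prop :=
  vertex_cover (underlying D) C /\
  forall x, x \in C ->
    (exists2 y, underlying D x y & y \notin C) \/
    (exists a, [/\ a \in C, 1 < weight D a, dedge D a x & out_nbh D a \subset C])%N.

Lemma vertex_cover_dedge C i j :
  vertex_cover (underlying D) C -> dedge D i j -> i \notin C -> j \in C.
Proof.
move=> /forallP/(_ i)/forallP/(_ j); rewrite /underlying => /implyP + ij.
by rewrite ij => /(_ isT)/orP[->|].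
Qed.

(* m witnesses that [var_ideal C] is the annihilator of 'X_[m] modulo the
   edge ideal. *)
Definition colon_witness C m : Prop :=
  (forall i, i \in C -> edge_mon (m + U_(i))%MM) /\
  (forall k, ~~ meets C k -> ~~ edge_mon (m + k)%MM).

Lemma meetsN C k i : ~~ meets C k -> i \in C -> k i = 0%N.
Proof. by move=> /existsPn/(_ i) + iC; rewrite iC /=; lia. Qed.

Lemma strong_cover_witness C : strong_cover C -> exists m, colon_witness C m.
Proof.
move=> [covC strC].
(* A vertex of [L1] gets exponent 0, so that ['X_i] is missing from its edge to a vertex outside
   [C]; any other vertex of [C] is one short of its weight. *)
pose L1 i := [exists j, dedge D i j && (j \notin C)].
pose m := [multinom if i \notin C then weight D i else
                    if L1 i then 0%N else (weight D i).-1 | i < n].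
exists m; split=> [i iC|k kC].
  have [/existsP[j /andP[ij jC]]|/existsPn iL1] := boolP (L1 i).
    apply/edge_monP; exists i, j; split=> //; first by rewrite mnmDE mnm1E eqxx addn1.
    by rewrite mnmDE mnmE jC leq_addr.
  have mi : (weight D i <= (m + U_(i))%MM i)%N.
    rewrite mnmDE mnmE iC mnm1E eqxx /= ifN ?addn1 ?leqSpred //.
    by apply/existsPn => j; rewrite iL1.
  case: (strC i iC) => [[y xy yC]|[a [aC wa ai /subsetP aout]]].
    have yi : dedge D y i.
      by case/orP: xy => // iy; have := iL1 y; rewrite iy yC.
    apply/edge_monP; exists y, i; split=> //.
    by rewrite mnmDE mnmE yC ltn_addr // weight_gt0.
  apply/edge_monP; exists a, i; split=> //.
  rewrite mnmDE mnmE aC /= ifN ?ltn_addr //; first by case: (weight D a) wa => [|[]].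
  by apply/existsPn => j; apply/negP => /andP[aj]; rewrite aout ?inE.
apply/negP => /edge_monP[i [j [ij]]].
have [jC _|jC] := boolP (j \in C).
  rewrite mnmDE mnmE jC (meetsN kC jC) addn0 /=.
  have := weight_gt0 D j; case: ifP; lia.
have iC : i \in C by apply: contraNT jC; apply: vertex_cover_dedge.
rewrite mnmDE mnmE iC (meetsN kC iC) addn0 /= ifT //.
by apply/existsP; exists j; rewrite ij.
Qed.

Lemma witness_strong_cover C m : colon_witness C m -> strong_cover C.
Proof.
move=> [mC mN].
(* Powers of the variables outside [C] cannot bring ['X_[m]] into the ideal, so vertices outside [C]
   count as having full exponent. *)
have noedge i j : dedge D i j -> (i \notin C) || (0 < m i)%N ->
    (j \notin C) || (weight D j <= m j)%N -> False.
  move=> ij iP jP; pose k := [multinom if x \in C then 0%N else weight D x | x < n].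
  have /mN/negP[] : ~~ meets C k.
    by apply/existsPn => x; rewrite mnmE; case: ifP.
  apply/edge_monP; exists i, j; rewrite !mnmDE !mnmE; split=> //.
    by case: (i \in C) iP => /=; rewrite ?addn0 // addn_gt0 weight_gt0 orbT.
  by case: (j \in C) jP => /=; rewrite ?addn0 // leq_addl.
(* Otherwise one more factor ['X_i] would complete no new edge. *)
have m_lt i : i \in C -> (m i < weight D i)%N.
  move=> iC; rewrite ltnNge; apply/negP => mi.
  have /edge_monP[p [q []]] := mC i iC; rewrite !mnmDE !mnm1E.
  have := weight_gt0 D i => wi.
  have mp : (0 < m i)%N by apply: leq_trans mi.
  case: (i =P p) => [<-|_]; case: (i =P q) => [<-|_]; rewrite /= => pq P1 P2;
  by apply: (noedge _ _ pq); apply/orP; right; lia.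
split.
  apply/forallP => i; apply/forallP => j; apply/implyP.
  case: (boolP (i \in C)) => //= iC; case: (boolP (j \in C)) => //= jC.
  by case/orP => ij; case: (noedge _ _ ij); rewrite ?iC ?jC.
move=> i iC; have /edge_monP[p [q [pq]]] := mC i iC; rewrite !mnmDE !mnm1E.
(* The edge from [p] to [q] completed by ['X_i] has [i] as tail or head. If [i] is the tail, [q] has
   full exponent and so lies outside [C]; if it is the head, [p] has positive exponent. *)
case: (i =P p) pq => [<-|_] pq.
  have iq : (i == q) = false.
    by apply: contraTF pq => /eqP<-; rewrite dedge_irr.
  rewrite iq addn0 => _ mq; left; exists q; first by rewrite /underlying pq.
  by apply/negP => /m_lt; rewrite ltnNge mq.
rewrite addn0 => mp; case: (i =P q) pq => [<-|_] pq; last first.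
  by rewrite addn0 => mq; case: (noedge _ _ pq); rewrite ?mp ?mq orbT.
move=> _; have [pC|pC] := boolP (p \in C); last first.
  by left; exists p; rewrite // /underlying pq orbT.
right; exists p; split=> //; first exact: leq_ltn_trans mp (m_lt p pC).
apply/subsetP => j; rewrite inE => pj; apply/negPn/negP => jC.
by apply: (noedge _ _ pj); rewrite ?mp ?jC ?orbT.
Qed.

Lemma strong_cover_associated C :
  strong_cover C -> associated_prime (edge_ideal K D) (var_ideal C).
Proof.
move=> /strong_cover_witness[m [mC mN]]; split; first exact: var_ideal_prime.
exists 'X_[m] => g; rewrite edge_idealP; split=> [gC k|gm k kg].
  rewrite (perm_mem (msuppMX g m)) => /mapP[k' /gC/existsP[i /andP[iC ki]] ->].
  have -> : k' = (U_(i) + (k' - U_(i)))%MM.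
    by rewrite addmC submK // lep1mP -lt0n.
  by rewrite addmA; apply/edge_mon_up/mC.
apply: contraT => /mN /negP[]; apply: gm.
by rewrite mcoeff_msupp mcoeffMX -mcoeff_msupp.
Qed.

(** [C] collects the variables in [P]. The leading monomial of the part of [f] that survives
    ['X_[B]] is a witness for [C]; comparing leading monomials also shows that every term of an
    element of [P] involves [C]. *)
Lemma associated_strong_cover (P : R -> Prop) :
  associated_prime (edge_ideal K D) P ->
  exists2 C, strong_cover C & forall f, P f <-> var_ideal C f.
Proof.
move=> [Pprime [f Pf']].
have Pf g : P g <-> monomial_ideal edge_mon (g * f) by rewrite Pf' edge_idealP.
have [idP P1 _] := Pprime.
pose C := [set i | all edge_mon (msupp ('X_i * f))].
have CP i : i \in C <-> P 'X_i by rewrite inE Pf; split=> [/allP|/allP].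
(* Multiplying by 'X_[B] kills the terms of f whose monomial u satisfies
   u k \in I for some k prime to C, and keeps the others outside I. *)
pose B := [multinom if i \in C then 0%N else weight D i | i < n].
have BC : ~~ meets C B by apply/existsPn => i; rewrite mnmE; case: ifP.
pose U m := edge_mon (m + B)%MM.
have Uup : upward_closed U.
  by move=> m k Um; rewrite /U -addmA [(k + B)%MM]addmC addmA; apply: edge_mon_up.
have idU := @monomial_ideal_ideal K n U Uup.
(* Exponents beyond the weights do not matter, so if some [k] free of [C] brings [m] into the ideal,
   [B] does. *)
have UN m k : ~~ U m -> ~~ meets C k -> ~~ edge_mon (m + k)%MM.
  move=> Um kC; apply: contra Um => /edge_monP[i [j [ij mi mj]]].
  apply/edge_monP; exists i, j; move: mi mj; rewrite !mnmDE ![B _]mnmE; split=> //.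
    by case: ifP mi => [/(meetsN kC)-> //|_ _]; rewrite addn_gt0 weight_gt0 orbT.
  by case: ifP mj => [/(meetsN kC)-> //|_ _]; rewrite leq_addl.
pose f0 := mrestr (predC U) f.
(* Otherwise ['X_[B]], hence one of its variables, would be in [P], though none of them belongs to
   [C]. *)
have f0_neq0 : f0 != 0.
  apply/eqP => /mrestrN_ideal Uf.
  have /(prime_idealX Pprime)[i] : P 'X_[B].
    apply/Pf => k; rewrite mulrC (perm_mem (msuppMX _ _)) => /mapP[m /Uf Um ->].
    by rewrite addmC.
  by rewrite mnmE => + /CP iC; rewrite iC.
have [mf Um] := msupp_mrestr (mlead_supp f0_neq0).
set m := mlead f0 in mf Um.
exists C.
  apply: (@witness_strong_cover C m); split=> [i /CP/Pf|k]; last exact: UN.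
  apply.
  by rewrite mcoeff_msupp mulrC addmC mcoeffMX -mcoeff_msupp.
have CsubP g : var_ideal C g -> P g.
  move=> gC; rewrite [g]mpolyE big_seq; apply: ideal_sum => // k /gC/existsP[i /andP[iC ki]].
  rewrite -mul_mpolyC; case: idP => _ _ PM; apply: (PM).
  have -> : k = ((k - U_(i)) + U_(i))%MM by rewrite submK // lep1mP -lt0n.
  by rewrite mpolyXD; apply/PM/CP.
move=> g; split=> [Pg|]; last exact: CsubP.
pose g0 := mrestr (predC (meets C)) g.
have [/mrestrN_ideal//|g0_neq0] := eqVneq g0 0.
exfalso; apply: (@monomial_idealM_neq K n U (predC U) (predC (meets C)) g0 f0) => //.
- move=> k k' /= kC k'U; rewrite /U [(k + k')%MM]addmC -addmA; apply: (UN k' (k + B)%MM k'U).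
  by rewrite meetsD (negPf kC).
- exact: mrestr_ideal.
- exact: mrestr_ideal.
have Pg0 : P g0.
  have -> : g0 = g - mrestr (meets C) g.
    by apply/eqP; rewrite eq_sym subr_eq addrC -mrestrD.
  by apply: idealB => //; apply: CsubP; apply: mrestr_ideal.
have -> : g0 * f0 = g0 * f - g0 * mrestr U f.
  by rewrite -mulrBr; congr (_ * _); apply/eqP; rewrite eq_sym subr_eq addrC -mrestrD.
apply: (idealB idU); last by case: idU => _ _; apply; apply: mrestr_ideal.
by move=> k /(iffLR (Pf g0) Pg0) Ik; apply: edge_mon_up.
Qed.

Lemma unmixed_strong_cover : unmixed (edge_ideal K D) <->
  exists h, forall C, strong_cover C -> #|C| = h.
Proof.
split=> -[h hP]; exists h; first move=> C strC.
  exact: has_height_uniq (var_ideal_height K C) (hP _ (strong_cover_associated strC)).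
move=> P /associated_strong_cover[C strC PC].
apply: (@has_height_ext K n (var_ideal C)) => [f|]; first by rewrite PC.
by rewrite -(hP C strC); apply: var_ideal_height.
Qed.

End EdgeIdeal.

(** * Very well-covered graphs *)

Local Open Scope nat_scope.

(** Hall's theorem, by induction on the size of [X], splitting along a tight proper subset if there
    is one. *)
Lemma hall_marriage (T : finType) (r : T -> {set T}) (X : {set T}) :
    (forall Y : {set T}, Y \subset X -> #|Y| <= #|\bigcup_(x in Y) r x|) ->
  exists2 f : T -> T, {in X &, injective f} & {in X, forall x, f x \in r x}.
Proof.
have [k] := ubnP #|X|; elim: k r X => // k IHk r X ltXk hallX.
pose N (Y : {set T}) := \bigcup_(x in Y) r x.
(* Both cases of the induction match a subset Y into B and then delete B from
   all r x: either Y is a proper subset with #|N Y| = #|Y| and B = N Y, or Y is a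
   singleton and B an arbitrary singleton in N Y. *)
have combine (B Y : {set T}) (g : T -> T) : Y \subset X -> Y != set0 ->
    {in Y &, injective g} -> {in Y, forall x, g x \in r x :&: B} ->
    (forall Z : {set T}, Z \subset X :\: Y -> #|Z| <= #|N Z :\: B|) ->
  exists2 f : T -> T, {in X &, injective f} & {in X, forall x, f x \in r x}.
  move=> sYX Y0 injg gr hallB.
  have [||f injf fr] := IHk (fun x => r x :\: B) (X :\: Y).
  - rewrite cardsD (setIidPr sYX); have := subset_leq_card sYX.
    by have := Y0; rewrite -card_gt0; lia.
  - move=> Z sZ; apply: leq_trans (hallB Z sZ) (subset_leq_card _).
    apply/subsetP => y; rewrite inE => /andP[yB /bigcupP[x xZ yx]].
    by apply/bigcupP; exists x; rewrite // inE yB.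
  have fB x : x \in X -> x \notin Y -> f x \in r x :\: B.
    by move=> xX xY; apply: fr; rewrite inE xY.
  exists (fun x => if x \in Y then g x else f x) => [x y xX yX|x xX]; last first.
    by case: ifPn => [/gr|/(fB x xX)]; rewrite inE => /andP[].
  case: ifPn => xY; case: ifPn => yY; first exact: injg.
  - have := gr x xY; have := fB y yX yY; rewrite !inE => /andP[yB _] /andP[_ xB] e.
    by rewrite -e xB in yB.
  - have := gr y yY; have := fB x xX xY; rewrite !inE => /andP[xB _] /andP[_ yB] e.
    by rewrite e yB in xB.
  by apply: injf; rewrite inE ?xY ?yY.
have [X0|/set0Pn[x xX]] := eqVneq X set0.
  by exists id => [? ?|?]; rewrite X0 inE.
have [/existsP[Y /and3P[pYX Y0 /eqP NY]]|/existsPn tight] :=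
  boolP [exists Y : {set T}, [&& Y \proper X, Y != set0 & #|N Y| == #|Y|]].
  have sYX := proper_sub pYX.
  have [||g injg gr] := IHk r Y.
  - exact: leq_trans (proper_card pYX) _.
  - by move=> Z sZY; apply: hallX; apply: subset_trans sYX.
  apply: (combine (N Y) Y g) => //.
    by move=> y yY; rewrite inE gr //; apply/bigcupP; exists y; rewrite ?gr.
  (* Hall's condition for [Z :|: Y] and [#|N Y| = #|Y|] leave at least [#|Z|] neighbours outside
     [N Y]. *)
  move=> Z; rewrite subsetD => /andP[sZX dZY].
  have := hallX (Z :|: Y); rewrite subUset sZX sYX bigcup_setU => /(_ isT).
  have := cardsUI Z Y; rewrite (disjoint_setI0 dZY) cards0.
  by have := cardsUI (N Z) (N Y); have := cardsID (N Y) (N Z); move: NY; rewrite /N; lia.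
have [y yx] : exists y, y \in r x.
  apply/card_gt0P; have := hallX [set x]; rewrite sub1set xX cards1 big_set1.
  exact.
apply: (combine [set y] [set x] (fun=> y)).
- by rewrite sub1set.
- by rewrite -card_gt0 cards1.
- by move=> z t /set1P-> /set1P->.
- by move=> z /set1P->; rewrite !inE yx eqxx.
move=> Z; rewrite subsetD disjoint_sym disjoints1 => /andP[sZX xZ].
have [->|Z0] := eqVneq Z set0; first by rewrite cards0.
(* As [Z] is not tight, [N Z] has an element to spare, which pays for [y]. *)
have := hallX Z sZX; have := tight Z; rewrite Z0 properE sZX.
have -> : ~~ (X \subset Z) by apply: contra xZ => /subsetP; apply.
rewrite -/(N Z) (cardsD1 y (N Z)) /=; case: (y \in N Z) => /=; lia.
Qed.

(** * Stable sets and the existence of a perfect matching *)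

Section Graphs.

Variables (T : finType) (e : rel T).
Hypotheses (e_sym : ssrbool.symmetric e) (e_irr : irreflexive e).
Implicit Types (S X A B C : {set T}) (P : {set {set T}}).

Lemma stableP S : reflect {in S &, forall x y, ~~ e x y} (stable e S).
Proof.
apply: (iffP forallP) => [st x y xS yS|st x].
  by have /implyP/(_ xS)/forallP/(_ y)/implyP/(_ yS) := st x.
by apply/implyP => xS; apply/forallP => y; apply/implyP; apply: st.
Qed.

Lemma stable_setC C : stable e (~: C) = vertex_cover e C.
Proof.
apply/stableP/forallP => [st x|cov x y].
  apply/forallP => y; apply/implyP; apply: contraTT.
  by rewrite negb_or => /andP[xC yC]; apply: st; rewrite inE.
rewrite !inE => xC yC; have /forallP/(_ y) := cov x.
by rewrite (negPf xC) (negPf yC) implybF.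
Qed.

Lemma stableS S X : X \subset S -> stable e S -> stable e X.
Proof.
by move=> /subsetP sXS /stableP st; apply/stableP => x y /sXS xS /sXS; apply: st.
Qed.

Lemma stable0 : stable e set0.
Proof. by apply/stableP => x y; rewrite inE. Qed.

Lemma maxset_stable_nbr S x : maxset (stable e) S -> x \notin S ->
  exists2 y, e x y & y \in S.
Proof.
move=> maxS xS; apply/exists_inP; apply: contraR xS => /exists_inPn xN.
have /stableP st := maxsetp maxS.
suff stx : stable e (x |: S).
  by rewrite -(maxsetsup maxS stx (subsetUr _ _)) setU11.
apply/stableP => y z /setU1P[->|yS] /setU1P[->|zS]; rewrite ?e_irr //.
- by apply: contraTN zS => xz; apply: xN.
- by rewrite e_sym; apply: contraTN yS => xy; apply: xN.
exact: st.
Qed.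

Definition nbhs X := [set y | [exists x in X, e x y]].

Lemma nbhsP X y : reflect (exists2 x, x \in X & e x y) (y \in nbhs X).
Proof. by rewrite inE; apply: exists_inP. Qed.

(* For B a maximal stable subset of the neighbourhood of X, replacing B by X in
   a maximal stable set through B shows that at most #|B| vertices of X have a
   neighbour in B; the induction deletes these from X and B from nbhs X. *)
Lemma well_covered_stable_nbhs X :
    well_covered e -> (forall x, ~~ isolated e x) -> stable e X ->
  #|X| <= #|nbhs X|.
Proof.
move=> wc noiso; have [k] := ubnP #|X|; elim: k X => // k IHk X ltXk stX.
have [->|/set0Pn[x0 x0X]] := eqVneq X set0; first by rewrite cards0.
have [B /maxsetP[/andP[stB sBN] maxB]] :
    {B | maxset (fun B => stable e B && (B \subset nbhs X)) B}.
  by apply: ex_maxset; exists set0; rewrite stable0 sub0set.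
pose X1 := X :\: nbhs B.
(* Some vertex of [X] is adjacent to [B], so [X1] is smaller than [X]. *)
have B0 : X :&: nbhs B != set0.
  have [y x0y] : exists y, e x0 y.
    by have := noiso x0; rewrite negb_forall => /existsP[y]; rewrite negbK; exists y.
  have yN : y \in nbhs X by apply/nbhsP; exists x0.
  have [z zB] : exists z, z \in B.
    apply/set0Pn; apply/eqP => B0; have yB : [set y] = B.
      apply: maxB; last by rewrite B0 sub0set.
      rewrite sub1set yN andbT.
      by apply/stableP => ? ? /set1P-> /set1P->; rewrite e_irr.
    by have := set11 y; rewrite yB B0 inE.
  have /nbhsP[x xX xz] := subsetP sBN z zB.
  by apply/set0Pn; exists x; rewrite inE xX; apply/nbhsP; exists z; rewrite // e_sym.
have leX1 : #|X1| <= #|nbhs X1|.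
  apply: IHk; last exact: stableS (subsetDl _ _) stX.
  by have := cardsID (nbhs B) X; rewrite -/X1; move: B0; rewrite -card_gt0; lia.
have sN1 : nbhs X1 \subset nbhs X :\: B.
  apply/subsetP => y /nbhsP[x]; rewrite inE => /andP[xB xX] xy.
  rewrite inE; apply/andP; split; last by apply/nbhsP; exists x.
  by apply: contra xB => yB; apply/nbhsP; exists y; rewrite // e_sym.
suff leXB : #|X :&: nbhs B| <= #|B|.
  have := cardsID (nbhs B) X; have := subset_leq_card sN1.
  by have := cardsID B (nbhs X); rewrite (setIidPr sBN) -/X1; lia.
have [S maxS sBS] := maxset_exists stB.
have /stableP stS := maxsetp maxS.
have SN : S :&: nbhs X = B.
  apply: maxB; last by rewrite subsetI sBS.
  by rewrite subsetIr andbT (stableS (subsetIl _ _)) //; apply: maxsetp maxS.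
have SX : S :&: X \subset X :\: nbhs B.
  apply/subsetP => x; rewrite !inE => /andP[xS ->]; rewrite andbT.
  apply/exists_inPn => y yB; have := stS y x (subsetP sBS y yB) xS; by [].
have stX' : stable e ((S :\: nbhs X) :|: X).
  have noe x y : x \in S :\: nbhs X -> y \in X -> ~~ e y x.
    rewrite inE => /andP[xN _] yX; apply: contra xN => yx.
    by apply/nbhsP; exists y.
  apply/stableP => x y /setUP[xS|xX] /setUP[yS|yX].
  - by move: xS yS; rewrite !inE => /andP[_ xS] /andP[_ yS]; apply: stS.
  - by rewrite e_sym; apply: noe.
  - exact: noe.
  - by move/stableP: stX; apply.
(* [S'] has the size of [S], so at most [#|B|] vertices of [X] lie outside [S]; these include all
   those adjacent to [B]. *)
have [S' maxS' sS'] := maxset_exists stX'.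
have := subset_leq_card sS'; rewrite -(wc _ _ maxS maxS').
have := cardsUI (S :\: nbhs X) X; have := cardsID (nbhs X) S.
have := cardsID (nbhs B) X; have := subset_leq_card SX.
have : (S :\: nbhs X) :&: X \subset S :&: X by rewrite setSI // subsetDl.
move/subset_leq_card; rewrite SN; lia.
Qed.

(** The complement of a minimum vertex cover is a maximal stable set, and it contains half of the
    vertices. *)
Lemma very_well_covered_card S :
  very_well_covered e -> maxset (stable e) S -> #|T| = 2 * #|S|.
Proof.
move=> [wc _ cardT] maxS.
have covT : vertex_cover e [set: T].
  by apply/forallP => x; apply/forallP => y; rewrite inE implybT.
move: cardT; rewrite /tau; case: arg_minnP => // C covC minC cardT.
have maxC : maxset (stable e) (~: C).
  apply/maxsetP; rewrite stable_setC; split=> // B stB sCB.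
  have := minC (~: B); rewrite -stable_setC setCK => /(_ stB) leCB.
  apply/esym/eqP; rewrite eqEcard sCB.
  by have := cardsC B; have := cardsC C; lia.
by rewrite (wc _ _ maxS maxC); have := cardsC C; lia.
Qed.

(** Hall's theorem matches a maximal stable set into its complement; both have half of the vertices,
    so none is left uncovered. *)
Lemma very_well_covered_perfect_matching :
  very_well_covered e -> exists P, perfect_matching e P.
Proof.
move=> vwc; have [wc noiso _] := vwc.
have [S maxS] : {S | maxset (stable e) S}.
  by apply: ex_maxset; exists set0; apply: stable0.
have stS := maxsetp maxS; have /stableP noS := stS.
have [|f injf fe] := @hall_marriage T (fun x => [set y | e x y]) S.
  move=> Y sYS; apply: leq_trans (well_covered_stable_nbhs wc noiso (stableS sYS stS)) _.
  apply/subset_leq_card/subsetP => y /nbhsP[x xY xy].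
  by apply/bigcupP; exists x; rewrite ?inE.
have {}fe x : x \in S -> e x (f x) by move/fe; rewrite inE.
have fS x : x \in S -> f x \notin S.
  by move=> xS; apply/negP => fxS; have := noS x (f x) xS fxS; rewrite fe.
have imfS : f @: S = ~: S.
  apply/eqP; rewrite eqEcard; apply/andP; split.
    by apply/subsetP => _ /imsetP[x xS ->]; rewrite inE fS.
  by rewrite card_in_imset //; have := very_well_covered_card vwc maxS;
    have := cardsC S; lia.
exists [set [set x; f x] | x in S]; apply/and3P; split.
- apply/subsetP => _ /imsetP[x xS ->]; apply/imset2P.
  by exists x (f x) => //; apply: fe.
- apply/trivIsetP => _ _ /imsetP[x xS ->] /imsetP[y yS ->] ne.
  have nxy : x != y by apply: contraNneq ne => ->.
  rewrite -setI_eq0; apply/eqP/setP => z; rewrite !inE.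
  apply/negP => /andP[/orP[]/eqP-> /orP[]/eqP e12].
  + by rewrite e12 eqxx in nxy.
  + by have := fS y yS; rewrite -e12 xS.
  + by have := fS x xS; rewrite e12 yS.
  + by rewrite (injf x y) ?eqxx in nxy.
apply/eqP/setP => z; rewrite inE; apply/bigcupP.
have [zS|zS] := boolP (z \in S).
  by exists [set z; f z]; [apply: imset_f | rewrite set21].
have /imsetP[x xS ->] : z \in f @: S by rewrite imfS inE.
by exists [set x; f x]; [apply: imset_f | rewrite set22].
Qed.

(** * Stable sets against the edges of a perfect matching *)

Section PerfectMatching.

Variable P : {set {set T}}.
Hypothesis P_perfect : perfect_matching e P.

Lemma matchingP A : A \in P -> exists x y, e x y /\ A = [set x; y].
Proof.
have /and3P[/subsetP sP _ _] := P_perfect.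
by move/sP/imset2P => [x y _ xy ->]; exists x, y.
Qed.

Lemma card_matching : #|T| = 2 * #|P|.
Proof.
have /and3P[_ trivP /eqP covP] := P_perfect.
rewrite -cardsT -covP -(eqP trivP) mulnC -sum_nat_const; apply: eq_bigr => A.
move/matchingP => [x [y [xy ->]]]; rewrite cards2.
by rewrite (contraTneq _ xy) // => ->; rewrite e_irr.
Qed.

Lemma card_setC_matching C : #|~: C| = #|P| -> #|C| = #|P|.
Proof. by have := cardsC C; rewrite card_matching; lia. Qed.

Lemma maxset_card_matching S :
  very_well_covered e -> maxset (stable e) S -> #|S| = #|P|.
Proof.
by move=> vwc maxS; have := very_well_covered_card vwc maxS; rewrite card_matching; lia.
Qed.

(** A stable set contains at most one end of each edge; summing over [P] gives the bound with its
    equality case. *)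
Lemma card_stable_matching S :
  stable e S -> #|S| <= #|P| ?= iff [forall A in P, S :&: A != set0].
Proof.
move=> /stableP stS; have /and3P[_ trivP /eqP covP] := P_perfect.
have -> : #|S| = \sum_(A in P) #|S :&: A|.
  transitivity (\sum_(x in cover P | x \in S) 1).
    by rewrite -sum1_card; apply: eq_bigl => x; rewrite covP inE.
  rewrite big_trivIset_cond //; apply: eq_bigr => A _.
  by rewrite -sum1_card; apply: eq_bigl => x; rewrite !inE andbC.
rewrite -[#|P|]sum1_card; apply: leqif_sum => A /matchingP[x [y [xy ->]]].
rewrite -card_gt0; suff le1 : #|S :&: [set x; y]| <= 1.
  by split=> //; case: #|_| le1 => [|[]].
rewrite leqNgt; apply/negP => /card_gt1P[u [v []]].
rewrite !inE => /andP[uS /orP[]/eqP eu] /andP[vS /orP[]/eqP ev] ne.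
- by rewrite eu ev eqxx in ne.
- by have := stS u v uS vS; rewrite eu ev xy.
- by have := stS u v uS vS; rewrite eu ev e_sym xy.
- by rewrite eu ev eqxx in ne.
Qed.

Lemma stable_meets_matching S x y :
  stable e S -> #|S| = #|P| -> [set x; y] \in P -> (x \in S) || (y \in S).
Proof.
move=> stS cardS xyP; have [_] := card_stable_matching stS.
rewrite cardS eqxx => /esym/forall_inP/(_ _ xyP)/set0Pn[z].
by rewrite !inE => /andP[zS /orP[]/eqP e1]; rewrite -e1 zS ?orbT.
Qed.

(* Otherwise a maximal stable set containing z and t would miss {x, y}. *)
Lemma very_well_covered_nbrs x y z t :
    very_well_covered e -> [set x; y] \in P -> e x z -> e y t ->
  z != t /\ e z t.
Proof.
move=> vwc xyP xz yt; suff zt : e z t.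
  by split=> //; apply: contraTneq zt => ->; rewrite e_irr.
apply/negPn/negP => nzt.
have st2 : stable e [set z; t].
  apply/stableP => u v /set2P[->|->] /set2P[->|->]; rewrite ?e_irr //.
  by rewrite e_sym.
have [S maxS /subsetP sS] := maxset_exists st2.
have stS := maxsetp maxS; have /stableP noS := stS.
have cardS := maxset_card_matching vwc maxS.
have /orP[xS|yS] := stable_meets_matching stS cardS xyP.
  by have := noS x z xS (sS _ (set21 z t)); rewrite xz.
by have := noS y t yS (sS _ (set22 z t)); rewrite yt.
Qed.

End PerfectMatching.
End Graphs.

(** * Unmixedness *)

Section Unmixed.

Variables (n : nat) (D : wograph n) (P : {set {set 'I_n}}).
Local Notation e := (underlying D).
Hypotheses (G_vwc : very_well_covered e) (P_perfect : perfect_matching e P).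
Implicit Types (a b : 'I_n) (C : {set 'I_n}).

Lemma underlying_sym : ssrbool.symmetric e.
Proof. by move=> x y; rewrite /underlying orbC. Qed.

Lemma underlying_irr : irreflexive e.
Proof. by move=> x; rewrite /underlying dedge_irr. Qed.

Lemma in_nbh_underlying x y : (y \in nbh D x) = e x y.
Proof. by rewrite !inE. Qed.

Definition matching_condition : Prop := forall a b b',
  1 < weight D a -> b' \in out_nbh D a -> [set b; b'] \in P ->
  nbh D b \subset out_nbh D a.

Lemma strong_cover_matching C x y : matching_condition ->
  strong_cover D C -> [set x; y] \in P -> ~~ ((x \in C) && (y \in C)).
Proof.
move=> mc [covC strC] xyP; apply/negP => /andP[xC yC].
have yxP : [set y; x] \in P by rewrite setUC.
have covN u v : e u v -> u \notin C -> v \notin C -> False.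
  move=> uv uC vC; have /forallP/(_ u)/forallP/(_ v) := covC.
  by rewrite uv (negPf uC) (negPf vC).
have out a b b' : [set b; b'] \in P -> 1 < weight D a -> dedge D a b' ->
    forall c, e b c -> dedge D a c.
  move=> bP wa ab' c bc; have b'a : b' \in out_nbh D a by rewrite inE.
  by have /subsetP/(_ c) := mc a b b' wa b'a bP; rewrite in_nbh_underlying inE; apply.
have outside a b b' c : [set b; b'] \in P -> 1 < weight D a -> dedge D a b' ->
    out_nbh D a \subset C -> e b c -> c \notin C -> False.
  move=> bP wa ab' /subsetP aC bc /negP[]; apply: aC.
  by rewrite inE; apply: out bP wa ab' _ bc.
case: (strC x xC) => [[z xz zC]|[a [aC wa ax aout]]];
  case: (strC y yC) => [[t yt tC]|[a' [aC' wa' ay aout']]].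
- have [_ zt] := very_well_covered_nbrs underlying_sym underlying_irr P_perfect G_vwc xyP xz yt.
  exact: covN zt zC tC.
- exact: (outside a' x y z).
- exact: (outside a y x t).
(* Both are strong through an in-neighbour: [a] points to [x], the partner of [y], hence to every
   neighbour of [y], in particular to [a']. *)
have aa' : dedge D a a'.
  by apply: (out a y x); rewrite // /underlying ay orbT.
have : dedge D a' a by apply: (out a' x y); rewrite // /underlying ax orbT.
by apply/negP/dedge_asym.
Qed.

Lemma strong_cover_card C :
  matching_condition -> strong_cover D C -> #|C| = #|P|.
Proof.
move=> mc strC; have [covC _] := strC.
have stC : stable e (~: C) by rewrite stable_setC.
have [_ eqP'] := card_stable_matching underlying_sym P_perfect stC.
apply: (card_setC_matching underlying_irr P_perfect); apply/eqP.
rewrite eqP'; apply/forall_inP => A AP.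
have [x [y [_ AE]]] := matchingP P_perfect AP.
have := strong_cover_matching mc strC; rewrite AE in AP * => /(_ x y AP).
rewrite negb_and => /orP[xC|yC]; apply/set0Pn; [exists x|exists y];
  by rewrite !inE eqxx ?orbT andbT.
Qed.

Lemma maxset_stable_strong_cover S :
  maxset (stable e) S -> strong_cover D (~: S).
Proof.
move=> maxS; split; first by rewrite -stable_setC setCK (maxsetp maxS).
move=> x; rewrite inE => xS; left.
have [y xy yS] := maxset_stable_nbr underlying_sym underlying_irr maxS xS.
by exists y; rewrite // inE yS.
Qed.

Lemma unmixed_matching_condition h :
  (forall C, strong_cover D C -> #|C| = h) -> matching_condition.
Proof.
move=> hP a b b' wa ab' bP; apply/subsetP => c.
rewrite in_nbh_underlying => bc; rewrite inE; apply/negPn/negP => ac; rewrite inE in ab'.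
(* The complement of a maximal stable set shows that [h] is [#|P|]. *)
have cardh C : strong_cover D C -> #|C| = #|P|.
  have [S maxS] : {S | maxset (stable e) S}.
    by apply: ex_maxset; exists set0; apply: stable0.
  move/hP->; rewrite -(hP _ (maxset_stable_strong_cover maxS)).
  apply: (card_setC_matching underlying_irr P_perfect); rewrite setCK.
  exact: (maxset_card_matching underlying_irr P_perfect G_vwc maxS).
have b'a : e b' a by rewrite /underlying ab' orbT.
have [nca eca] := very_well_covered_nbrs underlying_sym underlying_irr P_perfect
  G_vwc bP bc b'a.
have ca : dedge D c a by move: eca; rewrite /underlying (negPf ac) orbF.
pose F S := stable e S && [disjoint S & a |: out_nbh D a].
have Fc : F [set c].
  rewrite /F disjoints1 !inE negb_or nca ac !andbT.
  by apply/stableP => u v /set1P-> /set1P->; rewrite underlying_irr.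
have [S maxS cS] := maxset_exists Fc.
have /andP[/stableP stS dS] := maxsetp maxS; rewrite sub1set in cS.
have notS x : x \in a |: out_nbh D a -> x \notin S.
  by move=> xa; apply/negP => xS; have := disjointFr dS xS; rewrite xa.
have strS : strong_cover D (~: S).
  split; first by rewrite -stable_setC setCK; apply/stableP.
  move=> x; rewrite inE => xS.
  (* [a] is adjacent to [c], its out-neighbours are strong through [a], and any other vertex outside
     [S] has a neighbour in [S] by maximality. *)
  have [->|nxa] := eqVneq x a; first by left; exists c; rewrite ?inE ?cS // /underlying ca orbT.
  have [ax|nax] := boolP (dedge D a x).
    right; exists a; rewrite inE notS ?setU11 //; split=> //.
    by apply/subsetP => y ay; rewrite inE notS // inE ay orbT.
  left; have [/exists_inP[y yS xy]|/exists_inPn xN] := boolP [exists y in S, e x y].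
    by exists y; rewrite // inE yS.
  case/negP: xS; have <- : x |: S = S; last by rewrite setU11.
  apply: (maxsetsup maxS); last exact: subsetUr.
  rewrite /F disjoints_subset subUset sub1set -disjoints_subset dS.
  rewrite !inE negb_or nxa nax !andbT.
  apply/stableP => y z /setU1P[->|yS] /setU1P[->|zS]; rewrite ?underlying_irr //.
  - exact: xN.
  - by rewrite underlying_sym; apply: xN.
  exact: stS.
have cardS : #|S| = #|P|.
  by apply: (card_setC_matching underlying_irr P_perfect); apply: cardh.
have stS' : stable e S by apply/stableP.
(* [b] is adjacent to [c], which is in [S], and [b'] is an out-neighbour of [a], so [S] can contain
   neither. *)
have /orP[bS|b'S] := stable_meets_matching underlying_sym P_perfect stS' cardS bP.
  by have := stS b c bS cS; rewrite bc.
by have := notS b'; rewrite b'S !inE ab' orbT => /(_ isT).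
Qed.

End Unmixed.

Theorem corollary3p8 (K : fieldType) (n : nat) (D : wograph n)
  (weight_source_sink : forall x, source D x || sink D x -> weight D x = 1%N)
  (G_vwc : very_well_covered (underlying D)) :
  (exists P : {set {set 'I_n}}, perfect_matching (underlying D) P) /\
  (forall P : {set {set 'I_n}}, perfect_matching (underlying D) P ->
     (unmixed (edge_ideal K D) <->
      forall a b b' : 'I_n,
        (1 < weight D a)%N -> b' \in out_nbh D a -> [set b; b'] \in P ->
        nbh D b \subset out_nbh D a)).
Proof.
split.
  exact: very_well_covered_perfect_matching (@underlying_sym _ D) (@underlying_irr _ D) G_vwc.
move=> P P_perfect; rewrite unmixed_strong_cover; split=> [[h hP]|mc].
  exact: (unmixed_matching_condition G_vwc P_perfect hP).
by exists #|P| => C; apply: (strong_cover_card G_vwc P_perfect).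
Qed.
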